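(* Let $n\ge1$ and $X\in\mathfrak B^n$, and put $$P=(\mathfrak b^{\iota(2,n)}*X)\boxtimes(\mathfrak b^{\iota(2,n)+1}*X)\boxtimes\cdots\boxtimes(\mathfrak b^{\iota(2,n)+\mathfrak c(n)-1}*X).$$ Then $h^{\star}(n,X)=1$ if and only if both $P\boxtimes X=X$ and $P\ne I$, where $I=[1,0,\dots,0]\in\mathfrak B^n$.
   Context: $\mathfrak B^n=\{0,1\}^n$ is regarded as $\mathbb F_2^n$; vectors are indexed $X=[X_0,\dots,X_{n-1}]$ with indices modulo $n$. For a rule $X\in\mathfrak B^n$, the additive cellular automaton $\mathfrak A(n,X)$ has state set $\mathfrak B^n$ and transition map the linear operator $\hat X$, $(\hat X*s)_i=\bigoplus_{k=0}^{n-1}X_k s_{i+k\bmod n}$. A state $s$ is cyclic if $\hat X^t*s=s$ for some $t\ge1$; the height $h^{\star}(n,X)$ is the maximum over all states $s$ of the least $t\ge0$ such that $\hat X^t*s$ is cyclic. The associative operation $\boxtimes$ on $\mathfrak B^n$ is $(L\boxtimes M)_j=\bigoplus_{k=0}^{n-1}L_kM_{j-k\bmod n}$. The discrete baker transformation $\mathfrak b:\mathfrak B^n\to\mathfrak B^n$ is defined by $(\mathfrak b*X)_i=\bigoplus_{j\in\{0,\dots,n-1\}:\ 2j\equiv i\ (\mathrm{mod}\ n)}X_j$ (an empty sum being $0$); $\mathfrak b^k$ is its $k$-fold iterate, $\mathfrak b^0$ the identity. $\iota(2,n)$ is the exponent of the largest power of $2$ dividing $n$. Put $n'=n/2^{\iota(2,n)}$;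 then $\mathfrak c(n)=\mathrm{ord}_{n'}2$ (the least positive integer $x$ with $2^x\equiv1\ (\mathrm{mod}\ n')$) if $n'>1$, and $\mathfrak c(n)=1$ if $n'=1$. *)

(* Defs.v *)
From mathcomp Require Import all_boot all_algebra cyclic.

Set Implicit Arguments.
Unset Strict Implicit.
Unset Printing Implicit Defensive.

Import GRing.Theory.
Local Open Scope ring_scope.

(* The vector length is n.+1, so that the index type 'I_n.+1 has its canonical
   additive group structure, addition modulo n.+1: the index expressions
   i + k, j - k and j *+ 2 below are all taken modulo the vector length. *)
Notation states n := 'rV['F_2]_n.+1.

Definition transition n (X s : states n) : states n :=
  \row_i \sum_(k < n.+1) X 0 k * s 0 (i + k).

(* The connectivity test starts from the successor of s: at least one step is
   needed, so that transient states are not counted as cyclic (cyclicP). *)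
Definition cyclic_state n (X s : states n) : bool :=
  fconnect (transition X) (transition X s) s.

Lemma cyclicP n (X s : states n) :
  reflect (exists t, (1 <= t)%N /\ iter t (transition X) s = s)
          (cyclic_state X s).
Proof.
apply: (iffP idP) => [Hs | [t [t_gt0 Hs]]].
  exists (findex (transition X) (transition X s) s).+1; split=> //.
  by rewrite iterSr iter_findex.
move: Hs; rewrite -(prednK t_gt0) iterSr /cyclic_state => Hs.
by rewrite -{2}Hs fconnect_iter.
Qed.

Lemma cyclic_iter_ex n (X s : states n) :
  exists t, cyclic_state X (iter t (transition X) s).
Proof.
have /trajectP[j lt_j eq_j] := looping_order (transition X) s.
exists j; apply/cyclicP; exists (order (transition X) s - j)%N.
by rewrite subn_gt0 -iterD subnK // ltnW.
Qed.

Definition transient_length n (X s : states n) : nat :=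
  ex_minn (cyclic_iter_ex X s).

Definition height n (X : states n) : nat :=
  \max_(s : states n) transient_length X s.

Definition boxtimes n (L M : states n) : states n :=
  \row_j \sum_(k < n.+1) L 0 k * M 0 (j - k).

Definition unit_state n : states n := \row_i (i == 0)%:R.

Definition baker n (X : states n) : states n :=
  \row_i \sum_(j < n.+1 | j *+ 2 == i) X 0 j.

Definition iota2 (n : nat) : nat := logn 2 n.

Definition odd_part (n : nat) : nat := (n %/ 2 ^ iota2 n)%N.

Lemma coprime_odd_part n : (0 < n)%N -> coprime 2 (odd_part n).
Proof.
move=> n_gt0; have [m co2m def_n] := pfactor_coprime (isT : prime 2) n_gt0.
by rewrite /odd_part /iota2 {1}def_n mulnK // expn_gt0.
Qed.

Lemma ord_ex a m :
  coprime a m -> exists x, (0 < x)%N && (a ^ x == 1 %[mod m])%N.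
Proof.
case: (posnP m) => [-> | m_gt0 co_am].
  by rewrite /coprime gcdn0 => /eqP->; exists 1%N.
exists (totient m); rewrite totient_gt0 m_gt0 /=.
by apply/eqP/Euler_exp_totient.
Qed.

Definition ordmod a m (co_am : coprime a m) : nat := ex_minn (ord_ex co_am).

Definition period_exp n (n_gt0 : (0 < n)%N) : nat :=
  if (1 < odd_part n)%N then ordmod (coprime_odd_part n_gt0) else 1%N.

(* Main.v *)
(* Write T_X for the linear operator of the rule X. The map X |-> T_X is
   injective, turns boxtimes into composition, and in characteristic 2 it turns
   the baker map into squaring: T_(b X) = T_X^2. Hence T_P = T_X^e with
   e = 2^iota (2^c - 1). Since 2^(iota + c) = 2^iota modulo the length, also
   T_X^(2^iota + e) = T_X^(2^iota), so T_P fixes exactly the cyclic states.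
   Thus the height is at most t iff T_P T_X^t = T_X^t; the cases t = 1 and
   t = 0 read P boxtimes X = X and P = I. *)
Require Import Defs.
From mathcomp Require Import all_boot all_algebra.

Set Implicit Arguments.
Unset Strict Implicit.
Unset Printing Implicit Defensive.

Import GRing.Theory.
Local Open Scope ring_scope.

(** By symmetry the terms below the diagonal repeat those above it, and in characteristic 2 the two
    copies cancel. *)
Lemma sum_sym_pchar2 (R : nzRingType) m (F : 'I_m -> 'I_m -> R) :
    2%N \in [pchar R] -> (forall k l, F k l = F l k) ->
  \sum_k \sum_l F k l = \sum_k F k k.
Proof.
move=> R2 symF.
have splitF k : \sum_l F k l =
    F k k + (\sum_(l < m | (l < k)%N) F k l + \sum_(l < m | (k < l)%N) F k l).
  rewrite (bigD1 k) //= (bigID (fun l : 'I_m => l < k)%N) /=.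
  congr (_ + (_ + _)); apply: eq_bigl => l; rewrite -val_eqE /=; case: ltngtP=> //.
under eq_bigr do rewrite splitF.
rewrite big_split /= big_split /=.
rewrite [X in _ + (X + _)](exchange_big_dep predT) //=.
under [X in _ + (X + _)]eq_bigr do under eq_bigr do rewrite symF.
by rewrite (addrr_pchar2 R2) addr0.
Qed.

Section Operators.

Variable n : nat.
Implicit Types X Y s : states n.

Lemma transition_unit s : transition (unit_state n) s = s.
Proof.
apply/rowP=> i; rewrite mxE (bigD1 0) //= mxE eqxx mul1r addr0 big1 ?addr0 //.
by move=> k /negPf k0; rewrite mxE k0 mul0r.
Qed.

Lemma transition_boxtimes X Y s :
  transition (boxtimes X Y) s = transition X (transition Y s).
Proof.
apply/rowP=> i; rewrite !mxE.
under eq_bigr do rewrite mxE big_distrl /=.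
rewrite exchange_big /=; apply: eq_bigr => k _.
rewrite mxE big_distrr /= (reindex_inj (addIr k)) /=; apply: eq_bigr => l _.
by rewrite addrK mulrA -addrA (addrC k).
Qed.

(** A rule can be read off, with indices negated, from the image of the unit state. *)
Lemma transition_inj X Y : transition X =1 transition Y -> X = Y.
Proof.
have entry Z i : transition Z (unit_state n) 0 (- i) = Z 0 i.
  rewrite mxE (bigD1 i) //= mxE addNr eqxx mulr1 big1 ?addr0 // => k ki.
  by rewrite mxE addrC subr_eq0 (negPf ki) mulr0.
by move=> eqXY; apply/rowP=> i; rewrite -[LHS]entry -[RHS]entry eqXY.
Qed.

(** The baker map pushes coefficients forward along index doubling; dually, doubling is pulled back
    to [G]. *)
Lemma sum_baker X (G : 'I_n.+1 -> 'F_2) :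
  \sum_k baker X 0 k * G k = \sum_j X 0 j * G (j *+ 2).
Proof.
under eq_bigr do rewrite mxE big_distrl /=.
rewrite (exchange_big_dep predT) //=; apply: eq_bigr => j _.
by rewrite (big_pred1 (j *+ 2)) // => k; rewrite eq_sym.
Qed.

Lemma transition_baker X s :
  transition (baker X) s = transition X (transition X s).
Proof.
apply/rowP=> i; rewrite !mxE sum_baker.
under [RHS]eq_bigr do rewrite mxE big_distrr /=.
(* The double sum of [X 0 k * X 0 l * s 0 (i + k + l)] is symmetric in [k] and [l]; its diagonal has
   shifts [k *+ 2] and coefficients that are squares, hence unchanged in ['F_2]. *)
rewrite sum_sym_pchar2 ?pchar_Fp // => [|k l].
  apply: eq_bigr => k _; rewrite mulrA mulr2n addrA.
  by case: (X 0 k) => [[|[|//]] ?]; congr (_ * _); apply: val_inj.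
by rewrite mulrCA addrAC.
Qed.

Lemma transition_iter_baker k X s :
  transition (iter k (@baker n) X) s = iter (2 ^ k) (transition X) s.
Proof.
elim: k X s => [//|k IHk] X s; rewrite iterS transition_baker !IHk.
by rewrite -iterD addnn -mul2n expnS.
Qed.

(** A Frobenius formula: the coefficients stay those of [X] and only the shifts are multiplied, so
    the iterate depends on [2 ^ k] only modulo the length. *)
Lemma iter_transitionE k X s i :
  iter (2 ^ k) (transition X) s 0 i = \sum_j X 0 j * s 0 (i + j *+ 2 ^ k).
Proof.
rewrite -transition_iter_baker; elim: k X => [|k IHk] X; first by rewrite mxE.
rewrite iterSr IHk sum_baker; apply: eq_bigr => j _.
by rewrite -mulrnA -expnS.
Qed.

Lemma cyclic_state_transition X s :
  cyclic_state X s -> cyclic_state X (transition X s).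
Proof.
case/cyclicP=> t [t_gt0 st]; apply/cyclicP; exists t; split=> //.
by rewrite -iterSr iterS st.
Qed.

(** An orbit that has become cyclic stays cyclic, so the least such time is a threshold. *)
Lemma transient_length_leq X s t :
  (transient_length X s <= t)%N = cyclic_state X (iter t (transition X) s).
Proof.
rewrite /transient_length; case: ex_minnP => m cyc_m min_m.
apply/idP/idP=> [/subnK <-|/min_m //]; elim: (t - m)%N => [//|d IHd].
exact: cyclic_state_transition.
Qed.

Lemma height_leqP X t :
  reflect (forall s, cyclic_state X (iter t (transition X) s)) (height X <= t)%N.
Proof.
apply: (iffP (bigmax_leqP _ _ _)) => ht s => [|_]; last by rewrite transient_length_leq.
by rewrite -transient_length_leq ht.
Qed.

Lemma cyclic_state_eq_period X a e s : (0 < e)%N ->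
    (forall u, iter (a + e) (transition X) u = iter a (transition X) u) ->
  cyclic_state X s <-> iter e (transition X) s = s.
Proof.
move=> e_gt0 per; split=> [|se]; last by apply/cyclicP; exists e.
case/cyclicP=> t [t_gt0 st].
(* Going [a] times round the cycle writes [s] as an iterate of order at least [a], where [per]
   applies. *)
have sta : iter (t * a) (transition X) s = s.
  by elim: a {per} => [|a IHa]; rewrite ?muln0 // mulnS iterD IHa.
rewrite -{1}sta -iterD -(subnK (leq_pmull a t_gt0)) addnCA (addnC e) iterD per.
by rewrite -iterD subnK ?leq_pmull.
Qed.

End Operators.

Lemma period_exp_gt0 n (n_gt0 : (0 < n)%N) : (0 < period_exp n_gt0)%N.
Proof.
by rewrite /period_exp /ordmod; case: ifP => // _; case: ex_minnP => x /andP[].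
Qed.

(** The factor [2 ^ iota2 n] is cancelled from the modulus, which leaves a congruence to 1 modulo
    the odd part. *)
Lemma expn_period_exp n (n_gt0 : (0 < n)%N) :
  (2 ^ (iota2 n + period_exp n_gt0) = 2 ^ iota2 n %[mod n])%N.
Proof.
have def_n : n = (2 ^ iota2 n * odd_part n)%N.
  by rewrite mulnC divnK // pfactor_dvdnn.
have modE k : (2 ^ iota2 n * k %% n = 2 ^ iota2 n * (k %% odd_part n))%N.
  by rewrite muln_modr -def_n.
rewrite expnD -[in RHS](muln1 (2 ^ iota2 n)%N) !modE.
congr (_ * _)%N; rewrite /period_exp; case: ltnP => odd_n.
  by rewrite /ordmod; case: ex_minnP => x /andP[_ /eqP].
have ->: odd_part n = 1%N; last by rewrite !modn1.
by apply/eqP; rewrite eqn_leq odd_n; move: n_gt0; rewrite {1}def_n muln_gt0 => /andP[].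
Qed.

(** Here [a + a * (2 ^ c - 1)] is [2 ^ (iota2 n.+1 + c)], so both sides are iterates of order a
    power of 2 with congruent shifts. *)
Lemma iter_transition_period n (X s : states n)
    (a := (2 ^ iota2 n.+1)%N) (c := period_exp (ltn0Sn n)) :
  iter (a + a * (2 ^ c - 1)) (transition X) s = iter a (transition X) s.
Proof.
rewrite -{1}[a]muln1 -mulnDr subnKC ?expn_gt0 // -expnD.
apply/rowP=> i; rewrite !iter_transitionE; apply: eq_bigr => j _.
congr (_ * s 0 (_ + _)); apply: val_inj; rewrite !Zp_mulrn /=.
by rewrite -modnMmr expn_period_exp modnMmr.
Qed.

Theorem theorem12 (n : nat) (X : states n) :
  let P : states n :=
    \big[@boxtimes n / unit_state n]_(0 <= k < period_exp (ltn0Sn n))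
       iter (iota2 n.+1 + k) (@baker n) X in
  height X = 1%N <-> (boxtimes P X = X /\ P <> unit_state n).
Proof.
move=> P; set c := period_exp _ in P *; set a := (2 ^ iota2 n.+1)%N.
set e := (a * (2 ^ c - 1))%N.
(* A period must be positive; this follows from [1 <= c < 2 ^ c]. *)
have e_gt0 : (0 < e)%N.
  rewrite muln_gt0 expn_gt0 subn_gt0 /=.
  exact: leq_ltn_trans (period_exp_gt0 _) (ltn_expl _ _).
have TP s : transition P s = iter e (transition X) s.
  (* As a geometric sum, [e] matches the product [P] factor by factor. *)
  have ->: e = (\sum_(0 <= k < c) 2 ^ (iota2 n.+1 + k))%N.
    rewrite /e subn1 predn_exp mul1n big_distrr big_mkord /=.
    by apply: eq_bigr => k _; rewrite expnD.
  rewrite /P; move: s.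
  apply: (big_ind2 (fun Y k => forall s, transition Y s = iter k (transition X) s))
    => [s|Y1 k1 Y2 k2 IH1 IH2 s|k _ s].
  - exact: transition_unit.
  - by rewrite transition_boxtimes IH2 IH1 iterD.
  - exact: transition_iter_baker.
have htP t : (height X <= t)%N <->
    forall s, transition P (iter t (transition X) s) = iter t (transition X) s.
  have cycP s := cyclic_state_eq_period s e_gt0 (iter_transition_period X).
  split=> [/height_leqP ht s | ht]; first by rewrite TP; apply/cycP.
  by apply/height_leqP => s; apply/cycP; rewrite -TP.
have ht1 : (height X <= 1)%N <-> boxtimes P X = X.
  split=> [/htP PX | PX]; last by apply/htP=> s /=; rewrite -transition_boxtimes PX.
  by apply: transition_inj => s; rewrite transition_boxtimes PX.
have ht0 : (height X <= 0)%N <-> P = unit_state n.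
  split=> [/htP P1 | P1]; last by apply/htP=> s; rewrite P1 transition_unit.
  by apply: transition_inj => s; rewrite transition_unit P1.
split=> [htX | [/ht1 ht_le1 P1]]; first by split; [apply/ht1 | move/ht0]; rewrite htX.
by apply/eqP; rewrite eqn_leq ht_le1 ltnNge; apply/negP=> /ht0.
Qed.
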